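(* Let $n\ge 2$, let players $1,\dots,n$ have values $v_1\ge v_2\ge\cdots\ge v_n>0$, and let the tournament format be $(r,m_1,\dots,m_r)$, with $r_s = n-\sum_{j=1}^{s-1}m_j$. Let $X_1,\dots,X_r$ be independent random variables with $P(X_j=1)=\frac{2m_j}{r_j}=1-P(X_j=0)$, $j=1,\dots,r$, and let $N=\sum_{j=1}^r X_j$. Then for every $i\in\{1,\dots,n\}$ $$P_i \geq \sum_{g=1}^{i-1} P(N=g)\prod_{k=1}^{g}\frac{v_i}{v_i+v_k} + \sum_{g=i}^{r} P(N=g)\prod_{k=1}^{i-1}\frac{v_i}{v_i+v_k}\prod_{k=i+1}^{g+1}\frac{v_i}{v_i+v_k}.$$
   Context: Random knockout tournament: there are $n\ge 2$ players $1,\dots,n$ with positive values $v_1,\dots,v_n$. A format is a tuple $(r,m_1,\dots,m_r)$ of positive integers with $\sum_{s=1}^r m_s = n-1$ and $2m_s \le r_s$ for each $s$, where $r_s = n-\sum_{j=1}^{s-1} m_j$ is the number of players still alive (not eliminated) at the start of round $s$. In round $s$, independently of the past given the set of alive players, $2m_s$ of the $r_s$ alive players are chosen uniformly at random and are uniformly randomly arranged into $m_s$ match pairs. A match between $i$ and $j$ is won by $i$ with probability $v_i/(v_i+v_j)$, independently of everything else. Losers are eliminated; the winners and the alive players not chosen to play advance to the next round. After round $r$ exactly one player remains, the winner of the tournament. $P_i$ denotes the probability that player $i$ wins the tournament. Empty sums equal $0$ and empty products equal $1$. *)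

(* Defs.v *)
(* MathComp-Analysis *)
From HB Require Import structures.
From mathcomp Require Import all_boot all_order all_algebra.
From mathcomp Require Import all_classical all_reals all_analysis.

Set Implicit Arguments.
Unset Strict Implicit.
Unset Printing Implicit Defensive.

Import Order.TTheory GRing.Theory Num.Theory.
Import numFieldNormedType.Exports.

Local Open Scope ring_scope.

(* Players and rounds are numbered from 0: the ordinal k stands for player
   k + 1, and the ordinal s for round s + 1. *)

(* r_(s+1), the number of players alive before the round of index s. *)
Definition alive_count (n r : nat) (m : 'I_r -> nat) (s : nat) : nat :=
  (n - \sum_(j < r | (j < s)%N) m j)%N.

Definition is_format (n r : nat) (m : 'I_r -> nat) : Prop :=
  [/\ (0 < r)%N,
      forall s : 'I_r, (0 < m s)%N,
      (\sum_(s < r) m s = n - 1)%N &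
      forall s : 'I_r, (2 * m s <= alive_count n m s)%N].

(* The outcome of a round is a triple (S, M, W): the set S of players drawn to
   play, the set M of matches (a partition of S into pairs), and the set W of
   match winners. *)
Notation round n := ({set 'I_n} * {set {set 'I_n}} * {set 'I_n})%type.

Definition chosen n (x : round n) : {set 'I_n} := x.1.1.
Definition matches n (x : round n) : {set {set 'I_n}} := x.1.2.
Definition winners n (x : round n) : {set 'I_n} := x.2.
Definition losers n (x : round n) : {set 'I_n} := chosen x :\: winners x.

(* Players still alive before the round of index s, given the outcomes h of the
   rounds; only the rounds of index < s matter. *)
Definition alive (n r : nat) (h : 'I_r -> round n) (s : nat) : {set 'I_n} :=
  ~: \bigcup_(j < r | (j < s)%N) losers (h j).

Section RoundLaw.
Context {R : realType} {n : nat}.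
Implicit Types (A S W : {set 'I_n}) (M : {set {set 'I_n}}).

Definition uniform_pmf (T : finType) (D : {set T}) (x : T) : R :=
  (x \in D)%:R / #|D|%:R.

Definition draws A (k : nat) : {set {set 'I_n}} :=
  [set S : {set 'I_n} | (S \subset A) && (#|S| == k)]%SET.

Definition pairings S : {set {set {set 'I_n}}} :=
  [set M : {set {set 'I_n}} |
     finset.partition M S && [forall e in M, #|e| == 2%N]]%SET.

Definition match_prob (v : 'I_n -> R) (i j : 'I_n) : R := v i / (v i + v j).

(* W must contain exactly one player of each match; for a match e = {i, j} won
   by i, the two inner products reduce to the single factor v_i / (v_i + v_j). *)
Definition winners_pmf (v : 'I_n -> R) S M W : R :=
  (is_transversal W M S)%:R *
  \prod_(e in M) \prod_(i in e :&: W) \prod_(j in e :\: W) match_prob v i j.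

Definition round_pmf (v : 'I_n -> R) A (k : nat) (x : round n) : R :=
  uniform_pmf (draws A (2 * k)) (chosen x) *
  uniform_pmf (pairings (chosen x)) (matches x) *
  winners_pmf v (chosen x) (matches x) (winners x).

End RoundLaw.

Local Open Scope classical_set_scope.
Local Open Scope ereal_scope.

(* The random outcomes X_s of the rounds form a tournament with format m: given
   the whole past, the outcome of a round follows round_pmf on the set of
   players alive.  The conditional law is expressed by the chain rule, so that
   nothing is asked of pasts of probability zero. *)
Definition is_tournament d (Omega : measurableType d) (R : realType)
    (P : probability Omega R) (n r : nat) (v : 'I_n -> R) (m : 'I_r -> nat)
    (X : 'I_r -> Omega -> round n) : Prop :=
  (forall (s : 'I_r) (x : round n), measurable (X s @^-1` [set x])) /\
  (forall (h : 'I_r -> round n) (s : 'I_r),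
     P [set w | forall j : 'I_r, (j <= s)%N -> X j w = h j] =
     P [set w | forall j : 'I_r, (j < s)%N -> X j w = h j] *
     (round_pmf v (alive h s) (m s) (h s))%:E).

Definition wins (n r : nat) (Omega : Type) (X : 'I_r -> Omega -> round n)
    (i : 'I_n) : set Omega :=
  [set w | alive (fun s => X s w) r = [set i]%SET].

Definition mutually_independent d (Omega : measurableType d) (R : realType)
    (P : probability Omega R) (I : finType) (X : I -> {RV P >-> R}) : Prop :=
  forall (J : {set I}) (B : I -> set R), (forall j, measurable (B j)) ->
    P (\bigcap_(j in [set j | j \in J]) (X j @^-1` B j)) =
    \prod_(j in J) P (X j @^-1` B j).

(* Main.v *)
Require Import Defs.
From HB Require Import structures.
From mathcomp Require Import all_boot all_order all_algebra.
From mathcomp Require Import all_classical all_reals all_analysis.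
From mathcomp Require Import ring zify.

Set Implicit Arguments.
Unset Strict Implicit.
Unset Printing Implicit Defensive.

Import Order.TTheory GRing.Theory Num.Theory.
Import numFieldNormedType.Exports.

Local Open Scope ring_scope.

(** Fix a player i and write f k = v_i / (v_i + v_k) for its chance to beat k.
    The number of players alive before a round is fixed by the format, so as
    long as i is alive it is drawn in round s with probability 2 m_s / r_s,
    whatever happened before.  Hence the number of games that i plays when it is
    made to win them all is distributed as N.  Each of these games, against k
    say, costs a factor f k, and the opponents are distinct, because a beaten
    opponent is eliminated.  As f k is smaller for a stronger k, the product of
    f over g distinct opponents is at least the product over the g strongest
    players other than i ([strongest_le]).  Averaging this over the law of N is
    the claimed bound; its two sums separate the g for which the g strongest
    opponents all precede i from those for which i itself has to be skipped.

    The averaging is a backward induction on the rounds ([win_prob_ge]), stated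
    for a set D of opponents that i has already beaten: the product of f over D,
    times the chance that i wins from the present set of alive players, is at
    least the mean of the product of f over the |D| + g strongest opponents,
    where g is the number of games still to come.  The heart of the step is
    [round_mean]: once divided by the chance that i wins its own match, the
    event that i survives the round has total mass 1, and under this weighting
    i is still drawn with probability 2 m_s / r_s.

    The law of the number of games is carried by its generating polynomial, the
    product over the rounds of 1 - p + p X.  This product follows the recursion
    on the tournament side ([games_poly_format]), and on the side of N it
    expands into the sum over the possible sets of indices j with X_j = 1
    ([bernoulli_sum_law]).  Finally [wins_past] reads the probability that i
    wins, given the past, off the chain rule that defines a tournament. *)

(** * Sums and products over blocks and singletons *)

Section FiniteSets.
Import mathcomp.boot.fintype mathcomp.boot.finset.

(** A subset W of S is the same thing as the family of its traces e :&: W on the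
    blocks, so a sum of products over W factors block by block. *)
Lemma sum_over_blocks (R : comNzRingType) (I : finType) (S : {set I})
    (M : {set {set I}}) (h : {set I} -> {set I} -> R) :
  partition M S ->
  \sum_(W : {set I} | W \subset S) \prod_(e in M) h e (e :&: W)%SET =
  \prod_(e in M) \sum_(w : {set I} | w \subset e) h e w.
Proof.
move=> partM; rewrite (big_distr_big_dep set0).
have trivM := partition_trivIset partM.
rewrite [RHS](reindex_onto
  (fun W : {set I} => [ffun e => if e \in M then e :&: W else set0]%SET)
  (fun f : {ffun {set I} -> {set I}} => \bigcup_(e in M) f e)%SET) /=.
  apply: eq_big => [W|W _]; last by apply: eq_bigr => e eM; rewrite ffunE eM.
  rewrite (_ : _ \in _ = true) /=; last first.
    apply/pfamilyP; split=> [|e eM]; last by rewrite ffunE eM; exact: subsetIl.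
    by apply/subsetP=> e; rewrite !inE ffunE; case: ifP => // _; rewrite eqxx.
  rewrite (eq_bigr (fun e => e :&: W)%SET); last by move=> e eM; rewrite ffunE eM.
  rewrite -big_distrl /=.
  have -> : (\bigcup_(e in M) e = S)%SET by rewrite -(cover_partition partM).
  by rewrite setIC; apply/idP/eqP => /setIidPl.
move=> f /pfamilyP[/subsetP fM fsub]; apply/ffunP=> e; rewrite ffunE.
case: ifP => [eM|/negP eM]; last first.
  by apply/eqP; rewrite eq_sym; apply: contraT => fe; case: eM; apply: fM.
apply/setP=> x; rewrite !inE; apply/andP/idP.
  case=> xe /bigcupP[e' e'M xfe'].
  have xe' : x \in e' by apply: subsetP xfe'; exact: fsub.
  by rewrite -(def_pblock trivM eM xe) (def_pblock trivM e'M xe').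
move=> xfe; split; first by apply: subsetP xfe; exact: fsub.
by apply/bigcupP; exists e.
Qed.

Lemma sum_singletons (R : nzRingType) (I : finType) (e : {set I})
    (H : {set I} -> R) :
  \sum_(w : {set I} | w \subset e) (#|w| == 1)%:R * H w =
  \sum_(c in e) H [set c]%SET.
Proof.
rewrite (bigID (fun w : {set I} => #|w| == 1)) /= [X in _ + X]big1 ?addr0.
  rewrite -(big_imset H) /=; last by move=> x y _ _; apply: set1_inj.
  apply: eq_big => [w|w /andP[_ ->]]; last by rewrite mul1r.
  apply/andP/imsetP => [[we /cards1P[c wc]]|[c ce ->]].
    by exists c => //; rewrite -sub1set -wc.
  by rewrite sub1set cards1.
by move=> w /andP[_ /negPf ->]; rewrite mul0r.
Qed.

Lemma prod_bool (R : comNzRingType) (I : finType) (D : {set I}) (b : pred I) :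
  \prod_(e in D) (b e)%:R = [forall e in D, b e]%:R :> R.
Proof.
case: forall_inP => [bT|bF]; first by rewrite big1 // => e eD; rewrite bT.
have [e eD be] : exists2 e, e \in D & ~~ b e.
  apply/exists_inP; apply: contraT; rewrite negb_exists_in => /forall_inP h.
  by case: bF => e eD; rewrite -[b e]negbK h.
by rewrite (bigD1 e) //= (negPf be) mul0r.
Qed.

End FiniteSets.

(** * Laws of a number of games, as polynomials *)

Section Games.
Context {R : fieldType}.
Implicit Types (q : {poly R}) (phi : nat -> R).

(** The mean of [phi] under the law on the natural numbers whose generating
    polynomial is [q]. *)
Definition poly_mean q phi : R := \sum_(g < size q) q`_g * phi g.

Lemma poly_mean_widen K q phi : (size q <= K)%N ->
  poly_mean q phi = \sum_(g < K) q`_g * phi g.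
Proof.
move=> qK; rewrite /poly_mean (big_ord_widen K (fun g => q`_g * phi g) qK).
rewrite [LHS]big_mkcond; apply: eq_bigr => g _; case: ltnP => // qg.
by rewrite nth_default ?mul0r.
Qed.

(** One more trial, won with probability p, either shifts the count by one or
    leaves it as it is. *)
Lemma poly_mean_step p q phi :
  poly_mean (((1 - p)%:P + p *: 'X) * q) phi =
  p * poly_mean q (phi \o succn) + (1 - p) * poly_mean q phi.
Proof.
have coefL g : ((((1 - p)%:P + p *: 'X) * q)`_g =
    (1 - p) * q`_g + p * (if g is g'.+1 then q`_g' else 0)).
  by rewrite mulrDl mul_polyC -scalerAl coefD !coefZ coefXM; case: g.
rewrite (@poly_mean_widen (size q).+1); last first.
  apply/leq_sizeP => -[//|g] qg; rewrite coefL.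
  by rewrite !(nth_default 0) ?mulr0 ?addr0 // ltnW.
rewrite [X in _ = _ + _ * X](@poly_mean_widen (size q).+1) // [RHS]addrC.
under eq_bigr do rewrite coefL mulrDl.
rewrite big_split /=.
rewrite [X in _ + X]big_ord_recl mulr0 mul0r add0r /poly_mean.
by rewrite !mulr_sumr; congr (_ + _); apply: eq_bigr => g _; rewrite mulrA.
Qed.

(** Here [ms] lists the numbers of matches of the remaining rounds and [a] is the
    number of players alive. *)
Fixpoint games_poly (ms : seq nat) (a : nat) : {poly R} :=
  if ms is k :: ms' then
    ((1 - (2 * k)%:R / a%:R)%:P + ((2 * k)%:R / a%:R) *: 'X) * games_poly ms' (a - k)%N
  else 1.

End Games.

(** The conditions of a format, in a form that goes through an induction on the
    rounds. *)
Fixpoint fits (ms : seq nat) (a : nat) : bool :=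
  if ms is k :: ms' then (2 * k <= a)%N && fits ms' (a - k)%N else (a == 1)%N.

(** * One round, seen by one player *)

Section Round.
Import mathcomp.boot.fintype mathcomp.boot.finset.
Context {R : realType} {n : nat} (v : 'I_n -> R).
Hypothesis v_gt0 : forall k, 0 < v k.
Variable i : 'I_n.
Implicit Types (A S W e : {set 'I_n}) (M : {set {set 'I_n}}).

Lemma match_prob_gt0 j k : 0 < match_prob v j k.
Proof. by rewrite divr_gt0 ?addr_gt0. Qed.

Lemma match_prob_le1 j k : match_prob v j k <= 1.
Proof. by rewrite ler_pdivrMr ?addr_gt0 // mul1r lerDl ltW. Qed.

Lemma match_prob_sum1 j k : match_prob v j k + match_prob v k j = 1.
Proof.
rewrite /match_prob [v k + v j]addrC -mulrDl divff //.
by rewrite lt0r_neq0 ?addr_gt0.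
Qed.

(** The opponent of [i] as a set: a singleton if [i] plays and empty otherwise,
    since [pblock M i] is empty when no match contains [i].  Products over [foes]
    thus cover both cases. *)
Definition foes M : {set 'I_n} := (pblock M i :\ i)%SET.

Lemma foes_out M : i \notin cover M -> foes M = set0.
Proof.
move=> iM; rewrite /foes /pblock; case: pickP => [e /andP[eM ie]|_].
  by case/negP: iM; apply/bigcupP; exists e.
by apply/setP => k; rewrite !inE andbF.
Qed.

(** The two outcomes of a match have total probability 1; if [i] takes part, only
    the outcome in which [i] wins is kept. *)
Lemma block_survival e : #|e| = 2 ->
  \sum_(c in e) (((i \in e) ==> (i == c))%:R *
     \prod_(a in [set c]%SET) \prod_(b in (e :\: [set c])%SET) match_prob v a b)
  = if i \in e then \prod_(j in (e :\ i)%SET) match_prob v i j else 1.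
Proof.
move=> /eqP/cards2P[a [b [ab ->]]].
have Da : ([set a; b] :\ a = [set b])%SET.
  by apply/setP => x; rewrite !inE; case: eqVneq => // ->; rewrite (negPf ab).
have Db : ([set a; b] :\ b = [set a])%SET.
  by apply/setP => x; rewrite !inE; case: eqVneq => [->|];
     rewrite ?orbF // eq_sym (negPf ab).
rewrite big_setU1 ?inE //= !big_set1 Da Db !big_set1.
case: (eqVneq i a) => [->|ia] /=.
  by rewrite (negPf ab) mul1r mul0r addr0 Da big_set1.
case: (eqVneq i b) => [->|ib] /=; last by rewrite !mul1r match_prob_sum1.
by rewrite mul1r mul0r add0r Db big_set1.
Qed.

(** Both the transversality of W and the survival of [i] are conditions on the
    traces of W on the matches, so the summand has the product form that
    [sum_over_blocks] needs. *)
Lemma winners_pmfE S M W : partition M S -> W \subset S ->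
  winners_pmf v S M W * (i \notin S :\: W)%SET%:R =
  \prod_(e in M) ((#|e :&: W|%SET == 1)%:R *
    (((i \in e) ==> (i \in e :&: W)%SET)%:R *
     \prod_(a in (e :&: W)%SET) \prod_(b in (e :\: (e :&: W))%SET) match_prob v a b)).
Proof.
move=> partM WS; rewrite /winners_pmf /is_transversal partM WS /=.
have -> : (i \notin S :\: W)%SET = [forall e in M, (i \in e) ==> (i \in e :&: W)%SET].
  rewrite inE negb_and negbK; apply/idP/forall_inP => [h e eM|h].
    apply/implyP => ie; rewrite inE ie; case/orP: h => // /negP[].
    by rewrite -(cover_partition partM); apply/bigcupP; exists e.
  case: (boolP (i \in S)); rewrite ?orbT // orbF => iS.
  have iM : i \in cover M by rewrite (cover_partition partM).
  have := h _ (pblock_mem iM); rewrite mem_pblock iM inE mem_pblock iM.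
  by [].
rewrite !big_split /= mulrAC mulrA; congr (_ * _ * _).
- rewrite prod_bool; congr (nat_of_bool _)%:R.
  by apply: eq_forallb_in => e _; rewrite setIC.
- by rewrite prod_bool.
by apply: eq_bigr => e _; rewrite setDIr setDv set0U.
Qed.

(** Only the match of [i] can fail to sum to 1; if [i] does not play it survives
    for sure, in accordance with the empty product. *)
Lemma winners_survival S M : M \in pairings S ->
  \sum_W winners_pmf v S M W * (i \notin S :\: W)%:R =
  \prod_(j in foes M) match_prob v i j.
Proof.
rewrite inE => /andP[partM /forall_inP card2].
rewrite (bigID (fun W => W \subset S)) /= [X in _ + X]big1 ?addr0; last first.
  by move=> W /negPf WS; rewrite /winners_pmf /is_transversal WS andbF !mul0r.
rewrite (eq_bigr _ (fun W WS => winners_pmfE partM WS)).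
rewrite (sum_over_blocks (fun e w => (#|w| == 1)%:R * (((i \in e) ==> (i \in w))%:R *
     \prod_(a in w) \prod_(b in e :\: w) match_prob v a b)) partM).
transitivity (\prod_(e in M)
    (if i \in e then \prod_(j in e :\ i) match_prob v i j else 1)).
  apply: eq_bigr => e eM; rewrite sum_singletons -block_survival; last first.
    exact/eqP/card2.
  by apply: eq_bigr => c _; rewrite inE.
have [iS|iS] := boolP (i \in finset.cover M).
  rewrite (bigD1 (pblock M i)) ?pblock_mem //= mem_pblock iS.
  rewrite [X in _ * X]big1 ?mulr1 // => e /andP[eM eN]; case: ifP => // ie.
  by rewrite -(def_pblock (partition_trivIset partM) eM ie) eqxx in eN.
rewrite foes_out // big_set0 big1 // => e eM.
by case: ifP => // ie; case/negP: iS; apply/bigcupP; exists e.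
Qed.

Lemma uniform_sum (T : finType) (D : {set T}) (G : T -> R) :
  \sum_x uniform_pmf D x * G x = (\sum_(x in D) G x) / #|D|%:R.
Proof.
rewrite mulr_suml [RHS]big_mkcond; apply: eq_bigr => x _.
by rewrite /uniform_pmf; case: (x \in D); rewrite ?mul0r // mul1r mulrC.
Qed.

Lemma pairings_neq0 S : ~~ odd #|S| -> pairings S != set0.
Proof.
move: {2}(#|S|) (leqnn #|S|) => b; elim: b S => [|b IH] S Sb oS.
  move: Sb; rewrite leqn0 cards_eq0 => /eqP->; apply/set0Pn; exists set0.
  rewrite inE /partition /trivIset /cover !big_set0 cards0 !eqxx inE /=.
  by apply/forall_inP => e; rewrite inE.
have [S0|] := posnP #|S|; first by apply: IH => //; rewrite S0.
case/card_gt0P => a aS; have Sa : #|S| = #|S :\ a|.+1 by rewrite (cardsD1 a) aS.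
have /card_gt0P[c] : (0 < #|S :\ a|)%N by case: #|S :\ a| Sa oS => // ->.
rewrite !inE => /andP[ca cS].
have Sac : #|S :\ a| = #|S :\ a :\ c|.+1 by rewrite (cardsD1 c) !inE ca cS.
have /set0Pn[M] : pairings (S :\ a :\ c) != set0.
  apply: IH; [|move: oS]; rewrite Sa Sac /= ?negbK // in Sb *.
  by apply: leq_trans (leqnSn _) _.
rewrite inE => /andP[partM /forall_inP card2].
(* Pair two members of S and complete with a pairing of the others. *)
apply/set0Pn; exists ([set a; c] |: M); rewrite inE; apply/andP; split; last first.
  apply/forall_inP => e; rewrite !inE => /orP[/eqP->|]; last exact: card2.
  by rewrite cards2 (eq_sym a c) ca.
have -> : S = [set a; c] :|: (S :\ a :\ c).
  apply/setP => x; rewrite !inE; case: eqVneq => [->|_] //=.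
  by case: eqVneq => [->|_].
apply: partitionU1 => //; first by apply/set0Pn; exists a; rewrite !inE eqxx.
by rewrite disjoint_subset; apply/subsetP => x; rewrite !inE => /orP[]/eqP->;
   rewrite eqxx ?andbF.
Qed.

Lemma pairings_total S : ~~ odd #|S| -> \sum_M uniform_pmf (pairings S) M = 1 :> R.
Proof.
move=> oS; under eq_bigr do rewrite -[uniform_pmf _ _]mulr1.
rewrite uniform_sum sumr_const divff // pnatr_eq0 cards_eq0.
exact: pairings_neq0.
Qed.

(** A uniform draw of k members of A contains [i] with probability k / |A|: the
    draws that avoid [i] number 'C(|A| - 1, k) = (1 - k / |A|) 'C(|A|, k). *)
Lemma draws_mean A k (F : bool -> R) : i \in A -> (k <= #|A|)%N ->
  \sum_S uniform_pmf (draws A k) S * F (i \in S) =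
  k%:R / #|A|%:R * F true + (1 - k%:R / #|A|%:R) * F false.
Proof.
move=> iA kA; rewrite uniform_sum.
have cA : #|draws A k| = 'C(#|A|, k) by rewrite cards_draws.
have cA' : #|draws (A :\ i) k| = 'C(#|A|.-1, k).
  by rewrite cards_draws (cardsD1 i A) iA.
have a0 : (0 < #|A|)%N by apply/card_gt0P; exists i.
rewrite (bigID (fun S => i \in S)) /=.
rewrite (eq_bigr (fun=> F true)) => [|S /andP[_ ->]//].
rewrite [X in (_ + X) / _](eq_bigr (fun=> F false)) => [|S /andP[_ /negPf->]//].
rewrite !sumr_const.
have c0 : #|[pred S in draws A k | i \notin S]| = 'C(#|A|.-1, k).
  rewrite -cA'; apply: eq_card => S; rewrite !inE subsetD1.
  by rewrite andbAC.
have c1 : (#|[pred S in draws A k | i \in S]| + 'C(#|A|.-1, k) = 'C(#|A|, k))%N.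
  rewrite -cA -c0 -(cardID (fun S => i \in S) (draws A k)); congr addn.
  by apply: eq_card => S; rewrite !inE andbC.
rewrite cA c0 -[F true *+ _]mulr_natl -[F false *+ _]mulr_natl.
have := mul_bin_down #|A| k => /(congr1 (fun z => z%:R : R)).
rewrite !natrM natrB // => Ebin; move: c1 => /(congr1 (fun z => z%:R : R)).
rewrite natrD => c1.
have b0 : 'C(#|A|, k)%:R != 0 :> R by rewrite pnatr_eq0 -lt0n bin_gt0.
have a0' : #|A|%:R != 0 :> R by rewrite pnatr_eq0 -lt0n.
have N0 : 'C(#|A|.-1, k)%:R = (#|A|%:R - k%:R) * 'C(#|A|, k)%:R / #|A|%:R :> R.
  by rewrite -Ebin mulrAC divff // mul1r.
have N1 := canRL (addrK _) c1; rewrite N1 N0.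
by field; rewrite b0 a0'.
Qed.

(** Whatever the draw and the pairing, [i] survives with probability the product
    over [foes]; dividing by it leaves the law of the draw alone. *)
Lemma round_mean A k (F : bool -> R) : i \in A -> (2 * k <= #|A|)%N ->
  \sum_x round_pmf v A k x * ((i \notin losers x)%:R /
      \prod_(j in foes (matches x)) match_prob v i j * F (i \in chosen x)) =
  (2 * k)%:R / #|A|%:R * F true + (1 - (2 * k)%:R / #|A|%:R) * F false.
Proof.
move=> iA kA; rewrite -draws_mean //.
rewrite -(pair_bigA _ (fun SM W => round_pmf v A k (SM, W) * ((i \notin SM.1 :\: W)%:R /
      \prod_(j in foes SM.2) match_prob v i j * F (i \in SM.1)))) /=.
rewrite -(pair_bigA _ (fun S M => \sum_W round_pmf v A k (S, M, W) * ((i \notin S :\: W)%:R /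
      \prod_(j in foes M) match_prob v i j * F (i \in S)))) /=.
apply: eq_bigr => S _.
have [/[!inE]/andP[_ /eqP cS]|SD] := boolP (S \in draws A (2 * k)%N); last first.
  rewrite /uniform_pmf (negPf SD) !mul0r big1 // => M _; rewrite big1 // => W _.
  by rewrite /round_pmf /uniform_pmf /= (negPf SD) !mul0r.
rewrite -[RHS]mulr1 -[X in _ = _ * X](@pairings_total S); last by rewrite cS oddM.
rewrite mulr_sumr; apply: eq_bigr => M _.
have [MS|MS] := boolP (M \in pairings S); last first.
  rewrite /uniform_pmf (negPf MS) !(mul0r, mulr0) big1 // => W _.
  by rewrite /round_pmf /uniform_pmf /= (negPf MS) !(mul0r, mulr0).
have f0 : \prod_(j in foes M) match_prob v i j != 0.
  by rewrite lt0r_neq0 // prodr_gt0 // => j _; exact: match_prob_gt0.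
transitivity (uniform_pmf (draws A (2 * k)%N) S * uniform_pmf (pairings S) M *
    (\sum_W winners_pmf v S M W * (i \notin S :\: W)%:R) /
    (\prod_(j in foes M) match_prob v i j) * F (i \in S)).
  rewrite mulr_sumr !mulr_suml; apply: eq_bigr => W _.
  by rewrite /round_pmf /chosen /matches /winners /=; ring.
by rewrite winners_survival // mulfK //; ring.
Qed.

(** A surviving [i] has beaten its opponent, who is then no longer alive: this is
    what keeps the opponents of [i] distinct over the rounds. *)
Lemma round_support A k x : round_pmf v A k x != 0 ->
  [/\ losers x \subset A, #|losers x| = k,
      i \notin losers x -> foes (matches x) \subset losers x &
      #|foes (matches x)| = (i \in chosen x)].
Proof.
rewrite /round_pmf /uniform_pmf /winners_pmf.
case: x => [[S M] W]; rewrite /losers /chosen /matches /winners /=.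
case: (boolP (S \in draws _ _)) => [|_]; last by rewrite !mul0r eqxx.
case: (boolP (M \in pairings _)) => [|_]; last by rewrite !(mul0r, mulr0) eqxx.
case: (boolP (is_transversal _ _ _)) => [trW|_]; last by rewrite !(mul0r, mulr0) eqxx.
rewrite !inE => /andP[partM /forall_inP card2] /andP[SA /eqP cS] _.
have WS := transversal_sub trW.
have card2' : {in M, forall e : {set 'I_n}, #|e| = 2%N}.
  by move=> e eM; apply/eqP/card2.
have cM : (#|M| = k)%N.
  by have := card_uniform_partition card2' partM; rewrite cS mulnC; lia.
have iM : (i \in S) = (i \in cover M) by rewrite (cover_partition partM).
split.
- exact: subset_trans (subsetDl _ _) SA.
- by rewrite cardsD (setIidPr WS) cS (card_transversal trW) cM; lia.
- rewrite negb_and negbK => iW; apply/subsetP => j.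
  move=> mem_foes; have /[!inE]/andP[ji] := mem_foes.
  have [iC|iC] := boolP (i \in cover M); last first.
    by have := mem_foes; rewrite foes_out // inE.
  have {}iW : i \in W by case/orP: iW => //; rewrite iM iC.
  have bM := pblock_mem iC; move=> jb; apply/andP; split; last first.
    by rewrite -(cover_partition partM); apply/bigcupP; exists (pblock M i).
  case/and3P: trW => _ _ /forall_inP/(_ _ bM)/cards1P[c Wc].
  apply: contra ji => jW.
  have : j \in W :&: pblock M i by rewrite inE jW jb.
  have : i \in W :&: pblock M i by rewrite inE iW mem_pblock.
  by rewrite Wc !inE => /eqP-> /eqP->.
- rewrite iM; have [iC|iC] := boolP (i \in cover M); last first.
    by rewrite foes_out // cards0.
  have := cardsD1 i (pblock M i); rewrite mem_pblock iC card2' ?pblock_mem //.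
  by move=> [].
Qed.

Lemma round_pmf_ge0 A k x : 0 <= round_pmf v A k x.
Proof.
rewrite /round_pmf /uniform_pmf /winners_pmf !mulr_ge0 ?invr_ge0 ?ler0n //.
by do 3 (apply: prodr_ge0 => ? _); rewrite ltW // match_prob_gt0.
Qed.

(** The g strongest opponents of [i]: as the indices start at 0 and go by
    decreasing strength, these are the indices below g, with one more index when
    [i] is among them and has to be left out. *)
Definition strongest g : {set 'I_n} :=
  [set k : 'I_n | (k != i) && (k < g + (i < g))%N].

Lemma card_strongest g : (g < n)%N -> #|strongest g| = g.
Proof.
move=> gn; have tn : (g + (i < g) <= n)%N by case: (i < g)%N; lia.
have cT : #|[set k : 'I_n | k < g + (i < g)]%N| = (g + (i < g))%N.
  rewrite -[RHS]card_ord -[RHS]cardsT.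
  have winj : injective (widen_ord tn) by move=> a b /(congr1 val) /= /val_inj.
  rewrite -(card_imset _ winj); apply: eq_card => k.
  rewrite inE; apply/idP/imsetP => [kt|[j _ ->]]; last exact: (ltn_ord j).
  by exists (Ordinal kt) => //; apply: val_inj.
move: cT; rewrite (cardsD1 i) inE.
have -> : [set k : 'I_n | k < g + (i < g)]%N :\ i = strongest g.
  by apply/setP => k; rewrite !inE.
have -> : (i < g + (i < g))%N = (i < g)%N by case: (ltnP i g); lia.
by rewrite addnC => /addIn.
Qed.

Hypothesis v_dec : forall j k : 'I_n, (j <= k)%N -> v k <= v j.

Lemma match_prob_homo (j k : 'I_n) : (j <= k)%N -> match_prob v i j <= match_prob v i k.
Proof.
move=> jk; rewrite /match_prob ler_pM2l // lef_pV2 ?posrE ?addr_gt0 //.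
by rewrite lerD2l v_dec.
Qed.

(** An exchange argument: unless D lies within the strongest opponents, the two sets
    have equally many members outside their common part, and the chance to beat the
    player of threshold index t separates the chances against the former from those
    against the latter. *)
Lemma strongest_le (D : {set 'I_n}) : i \notin D ->
  \prod_(k in strongest #|D|) match_prob v i k <= \prod_(k in D) match_prob v i k.
Proof.
move=> iD; set S := strongest #|D|.
rewrite (big_setID D) [leRHS](big_setID S) /= setIC ler_wpM2l //.
  by apply: prodr_ge0 => k _; rewrite ltW ?match_prob_gt0.
have [->|/set0Pn[k0]] := eqVneq (D :\: S) set0.
  rewrite big_set0 prodr_ile1 // => k _.
  by rewrite match_prob_le1 ltW ?match_prob_gt0.
rewrite !inE => /andP[k0S k0D].
have k0i : k0 != i by apply: contraNneq iD => <-.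
have Dn : (#|D| < n)%N.
  have : (#|D| <= #|[set~ i]|)%N.
    by apply/subset_leq_card/subsetP => k kD; rewrite !inE; apply: contraNneq iD => <-.
  by rewrite cardsC1 card_ord; have := ltn_ord i; lia.
have [t [tS tD]] : exists t : 'I_n, (forall k, k \in S -> (k <= t)%N) /\
    (forall k, k \in D :\: S -> (t <= k)%N).
  have tn : (#|D| + (i < #|D|) < n)%N.
    by move: k0S; rewrite negb_and k0i /= -leqNgt => /leq_ltn_trans; apply.
  exists (Ordinal tn); split => k; rewrite !inE /=; first by case/andP => _ /ltnW.
  case/andP; rewrite negb_and negbK -leqNgt => /orP[/eqP->|//].
  by rewrite (negPf iD).
have cSD : #|S :\: D| = #|D :\: S|.
  by have := cardsID D S; have := cardsID S D; rewrite card_strongest // setIC; lia.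
apply: (@le_trans _ _ (match_prob v i t ^+ #|S :\: D|)).
  rewrite -prodr_const; apply: ler_prod => k; rewrite inE => /andP[_ /tS kt].
  by rewrite match_prob_homo // ltW ?match_prob_gt0.
rewrite cSD -prodr_const; apply: ler_prod => k /tD tk.
by rewrite match_prob_homo // ltW ?match_prob_gt0.
Qed.

(** * Winning the tournament *)

(** The probability that [i] wins when [A] is the set of players alive and [ms]
    lists the numbers of matches of the remaining rounds. *)
Fixpoint win_prob (ms : seq nat) A : R :=
  if ms is k :: ms' then
    \sum_x round_pmf v A k x * win_prob ms' (A :\: losers x)
  else (A == [set i])%:R.

Lemma win_prob_ge0 ms A : 0 <= win_prob ms A.
Proof.
elim: ms A => [|k ms IH] A /=; first exact: ler0n.
by apply: sumr_ge0 => x _; rewrite mulr_ge0 ?round_pmf_ge0.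
Qed.

(** A general D is needed for the induction: the opponent beaten in the current
    round joins D, and it is new to D because D is disjoint from the players
    alive. *)
Lemma win_prob_ge ms A (D : {set 'I_n}) : i \in A -> [disjoint D & A] ->
  fits ms #|A| ->
  poly_mean (games_poly ms #|A|)
    (fun g => \prod_(k in strongest (#|D| + g)) match_prob v i k)
  <= \prod_(k in D) match_prob v i k * win_prob ms A.
Proof.
elim: ms A D => [|m ms IH] A D iA DA /=.
  move=> /cards1P[a Aa]; rewrite /poly_mean size_poly1 big_ord1.
  have ia : a = i by move: iA; rewrite Aa !inE => /eqP.
  rewrite Aa ia eqxx coef1 mul1r mulr1 /= addn0; apply: strongest_le.
  by rewrite (disjointFl DA).
move=> /andP[mA msA]; rewrite poly_mean_step.
set e1 := poly_mean _ _; set e0 := poly_mean _ _.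
have /= <- := @round_mean A m (fun b => if b then e1 else e0) iA mA.
rewrite mulr_sumr.
apply: ler_sum => x _; rewrite [leRHS]mulrCA.
have [->|x0] := eqVneq (round_pmf v A m x) 0; first by rewrite !mul0r.
rewrite ler_wpM2l ?round_pmf_ge0 //.
have [lA cl foesl cfoes] := round_support x0.
have D0 : 0 < \prod_(k in D) match_prob v i k.
  by apply: prodr_gt0 => k _; exact: match_prob_gt0.
(* The outcomes in which i loses are discarded: they contribute 0 to the lower
   bound. *)
have [il|il] := boolP (i \in losers x).
  by rewrite /= !mul0r mulr_ge0 ?win_prob_ge0 ?ltW.
rewrite mul1r ler_pdivrMl; last by apply: prodr_gt0 => k _; exact: match_prob_gt0.
have cA : #|A :\: losers x| = (#|A| - m)%N by rewrite cardsD (setIidPr lA) cl.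
have DF : [disjoint D & foes (matches x)].
  apply: disjointWr DA; exact: subset_trans (foesl il) lA.
have DF' : [disjoint D :|: foes (matches x) & A :\: losers x].
  rewrite disjoints_subset subUset -!disjoints_subset.
  rewrite (disjointWr (subsetDl _ _) DA) disjoints_subset.
  apply/subsetP => k /(subsetP (foesl il)) kl.
  by rewrite in_setC in_setD kl.
have := IH (A :\: losers x) (D :|: foes (matches x)).
rewrite inE il iA cA => /(_ isT DF' msA).
rewrite (cardsU D) disjoint_setI0 // cards0 subn0 cfoes.
have -> : \prod_(k in D :|: foes (matches x)) match_prob v i k =
    \prod_(k in foes (matches x)) match_prob v i k *
    \prod_(k in D) match_prob v i k.
  by rewrite mulrC -bigU //; apply: eq_bigl => k; rewrite !inE.
rewrite -mulrA.
apply: le_trans; rewrite /e1 /e0.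
case: (i \in chosen x); rewrite le_eqVlt; apply/orP; left; apply/eqP.
  by apply: eq_bigr => g _; rewrite /= addn1 addSnnS.
by apply: eq_bigr => g _; rewrite addn0.
Qed.
End Round.

Local Open Scope classical_set_scope.

(** * Random variables with finitely many values *)

Section FiniteValued.
Context {d : measure_display} {Omega : measurableType d} {T : finType}.
Variable f : Omega -> T.
Hypothesis f_fibers : forall x, measurable (f @^-1` [set x]).

Lemma measurable_finite_preimage (B : set T) : measurable (f @^-1` B).
Proof.
have -> : f @^-1` B = \bigcup_(x in B) f @^-1` [set x].
  by apply/seteqP; split=> [w Bfw|w [x Bx /= ->]//]; exists (f w).
by apply: fin_bigcup_measurable => // x _.
Qed.

Lemma measure_split (R : realType) (P : probability Omega R) (E : set Omega) :
  measurable E -> P E = (\sum_x P (E `&` f @^-1` [set x]))%E.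
Proof.
move=> mE.
have {1}-> : E = \bigcup_(x in [set: T]) (E `&` f @^-1` [set x]).
  by apply/seteqP; split=> [w Ew|w [x _ []]//]; exists (f w).
rewrite measure_fin_bigcup //; last 3 first.
- exact: finite_finset.
- by apply/trivIsetP => x y _ _ xy; apply/seteqP; split=> // w [[_ /= fx] [_ /= fy]];
    rewrite -fx -fy eqxx in xy.
- by move=> x _; apply: measurableI.
rewrite (fsbigE (index_enum T)) ?index_enum_uniq //; last first.
  by move=> x _; rewrite mem_index_enum.
by apply: eq_bigl => x; rewrite in_setT.
Qed.

End FiniteValued.

Lemma measure_eq_ae d (Omega : measurableType d) (R : realType)
    (mu : {measure set Omega -> \bar R}) (Z A B : set Omega) :
  {ae mu, forall w, Z w} -> measurable A -> measurable B ->
  (forall w, Z w -> A w <-> B w) -> mu A = mu B.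
Proof.
move=> [N [mN N0 ZN]] mA mB AB.
have off (C : set Omega) : measurable C -> mu C = mu (C `\` N).
  move=> mC; rewrite (measureDI mu mC mN) [X in (_ + X)%E](_ : _ = 0%E) ?adde0 //.
  apply/eqP; rewrite -measure_le0 -N0.
  by apply: le_measure; rewrite ?inE //; exact: measurableI.
rewrite off // [RHS]off //; congr (mu _); apply/seteqP.
have ZN' w : ~ N w -> Z w by move=> Nw; apply: contrapT => Zw; apply/Nw/ZN.
by split=> w [Cw Nw]; split=> //; apply/AB => //; exact: ZN'.
Qed.

(** * Sums of independent Bernoulli variables *)

Section BernoulliSum.
Context {d : measure_display} {Omega : measurableType d} {R : realType}.
Context {Q : probability Omega R} {r : nat}.
Variables (X : 'I_r -> {RV Q >-> R}) (p : 'I_r -> R).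
Hypothesis X_indep : mutually_independent X.
Hypothesis X1 : forall j, Q [set w | X j w = 1] = (p j)%:E.
Hypothesis X0 : forall j, Q [set w | X j w = 0] = (1 - p j)%:E.

Lemma measurable_value j c : measurable [set w | X j w = c].
Proof.
have -> : [set w | X j w = c] = X j @^-1` [set c] by [].
by rewrite -[_ @^-1` _]setTI; exact: measurable_funP.
Qed.

(** The two given probabilities add up to 1. *)
Lemma ae_bernoulli : {ae Q, forall w j, X j w = 1 \/ X j w = 0}.
Proof.
apply: filter_forall => j.
apply/negligibleP.
  by apply: measurableC; apply: measurableU; exact: measurable_value.
have -> : [set w | X j w = 1 \/ X j w = 0] =
    [set w | X j w = 1] `|` [set w | X j w = 0] by [].
apply: (etrans (@probability_setC _ _ _ Q _ _)).
  by apply: measurableU; exact: measurable_value.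
have -> : Q ([set w | X j w = 1] `|` [set w | X j w = 0]) =
    ((p j)%:E + (1 - p j)%:E)%E.
  rewrite -X1 -X0; apply: measureU; try exact: measurable_value.
  by apply/seteqP; split => // w [/= -> /eqP]; rewrite oner_eq0.
by rewrite -EFinD subrKC subrr.
Qed.

Definition bernoulli_gen : {poly R} := \prod_j ((1 - p j)%:P + p j *: 'X).

Lemma bernoulli_genE g : bernoulli_gen`_g =
  \sum_(J : {set 'I_r} | #|J| == g) \prod_j (if j \in J then p j else 1 - p j).
Proof.
rewrite /bernoulli_gen; under eq_bigr do rewrite addrC.
rewrite bigA_distr coef_sum [RHS]big_mkcond; apply: eq_bigr => J _.
have -> : \prod_j (if j \in J then p j *: 'X else (1 - p j)%:P) =
    (\prod_j (if j \in J then p j else 1 - p j)) *: 'X^#|J|.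
  rewrite -prodr_const [X in _ *: X]big_mkcond -scaler_prod.
  by apply: eq_bigr => j _; case: ifP => _; rewrite ?alg_polyC.
by rewrite coefZ coefXn eq_sym; case: eqVneq; rewrite ?mulr1 ?mulr0.
Qed.

(** Almost surely the event is the disjoint union, over the sets J of g indices, of
    the events that the X_j equal to 1 are those with j in J; independence gives the
    probability of each as a product. *)
Lemma bernoulli_sum_law g :
  Q [set w | \sum_j X j w = g%:R] = (bernoulli_gen`_g)%:E.
Proof.
set E := [set w | _].
have mE : measurable E.
  have -> : E = (fun w => \sum_j X j w) @^-1` [set g%:R] by [].
  rewrite -[_ @^-1` _]setTI.
  by apply: (@measurable_sum _ _ _ _ _ _ (fun j w => X j w)).
pose ones w : {set 'I_r} := [set j | X j w == 1]%SET.
pose cell (J : {set 'I_r}) := [set w | forall j, X j w = (j \in J)%:R].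
have mcell (G : 'I_r -> set R) : (forall j, measurable (G j)) ->
    measurable [set w | forall j, G j (X j w)].
  move=> mG; have -> : [set w | forall j, G j (X j w)] =
      \bigcap_(j in [set: 'I_r]) (X j @^-1` G j).
    by apply/seteqP; split=> [w Gw j _|w Gw j]; [exact: Gw | exact: (Gw j I)].
  apply: fin_bigcap_measurable => // j _.
  by rewrite -[_ @^-1` _]setTI; exact: measurable_funP.
have ones_fibers J : measurable (ones @^-1` [set J]).
  have -> : ones @^-1` [set J] = [set w | forall j,
      (if j \in J then [set 1] else ~` [set 1]) (X j w)].
    apply/seteqP; split=> [w /= <- j|w /= Jw].
      by rewrite inE; case: eqP.
    by apply/setP => j; rewrite inE; have := Jw j; case: (j \in J) => /eqP // /negPf.
  by apply: (mcell (fun j => if j \in J then [set 1] else ~` [set 1])) => j;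
     case: ifP => _; [|apply: measurableC]; exact: measurable_set1.
rewrite (measure_split ones_fibers) // bernoulli_genE [X in _ = X%:E]big_mkcond -sumEFin.
apply: eq_bigr => J _.
have cellE : Q (cell J) = (\prod_j (if j \in J then p j else 1 - p j))%:E.
  have -> : cell J = \bigcap_(j in [set j | j \in [set: 'I_r]%SET])
      (X j @^-1` [set (j \in J)%:R]).
    by apply/seteqP; split=> [w Jw j _|w Jw j]; [exact: Jw | apply: Jw; rewrite /= inE].
  rewrite (X_indep _ (fun j => @measurable_set1 _ (j \in J)%:R)) -prodEFin.
  apply: eq_big => j; first by rewrite inE.
  by move=> _; case: (j \in J); [exact: X1 | exact: X0].
have sum_cell w : cell J w -> \sum_j X j w = #|J|%:R.
  move=> Jw; under eq_bigr do rewrite Jw.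
  by rewrite -natr_sum -sum1_card [in RHS]big_mkcond.
have ones_cell w : (forall j, X j w = 1 \/ X j w = 0) -> ones w = J -> cell J w.
  move=> Zw <- j; rewrite inE.
  by case: (Zw j) => ->; rewrite ?eqxx // eq_sym oner_eq0.
have mEJ : measurable (E `&` ones @^-1` [set J]) by exact: measurableI.
have [Jg|Jg] := eqVneq #|J| g.
  rewrite -cellE; apply: (measure_eq_ae ae_bernoulli) => //.
    by apply: (mcell (fun j => [set (j \in J)%:R])) => j; exact: measurable_set1.
  move=> w Zw; split=> [[_ /ones_cell]|Jw]; first exact.
  split; first by rewrite /E /= sum_cell ?Jg.
  by apply/setP => j; rewrite inE Jw; case: (j \in J); rewrite ?eqxx // eq_sym oner_eq0.
rewrite -[RHS](measure0 Q); apply: (measure_eq_ae ae_bernoulli) => // w Zw.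
split=> // -[Ew /(ones_cell _ Zw)/sum_cell]; rewrite Ew => /eqP.
by rewrite eqr_nat eq_sym (negPf Jg).
Qed.
End BernoulliSum.

(** * The chain rule along the rounds *)

Section Format.
Context {n r : nat}.
Variable m : 'I_r -> nat.

Definition rounds_from (s : nat) : seq nat := drop s [seq m j | j <- enum 'I_r].

Lemma rounds_fromS (s : 'I_r) : rounds_from s = m s :: rounds_from s.+1.
Proof.
rewrite /rounds_from (drop_nth 0%N); last by rewrite size_map size_enum_ord.
by rewrite (nth_map s) ?nth_ord_enum // size_enum_ord.
Qed.

Lemma rounds_from_end : rounds_from r = [::].
Proof. by rewrite /rounds_from drop_oversize // size_map size_enum_ord. Qed.

Lemma alive_countS (s : 'I_r) :
  alive_count n m s.+1 = (alive_count n m s - m s)%N.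
Proof.
rewrite /alive_count -subnDA (bigD1 s) //= addnC; congr (_ - (_ + _))%N.
by apply: eq_bigl => j; rewrite ltnS ltn_neqAle andbC.
Qed.

Lemma alive_count0 : alive_count n m 0 = n.
Proof. by rewrite /alive_count big1 ?subn0. Qed.

Lemma round_ind (Pr : nat -> Prop) :
  Pr r -> (forall s : 'I_r, Pr s.+1 -> Pr s) -> forall s, (s <= r)%N -> Pr s.
Proof.
move=> Pend PS s sr; rewrite -(subKn sr).
elim: (r - s)%N (leq_subr s r) => [|k IH] kr; first by rewrite subn0.
have kr' : (r - k.+1 < r)%N by lia.
by apply: (PS (Ordinal kr')); rewrite /= subnSK //; apply: IH; exact: ltnW.
Qed.

Hypotheses (n_gt0 : (0 < n)%N) (fm : is_format n m).

Lemma fits_format s : (s <= r)%N -> fits (rounds_from s) (alive_count n m s).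
Proof.
case: fm => r0 _ sum_m twice.
elim/round_ind: s / => [|s IH].
  rewrite rounds_from_end /= /alive_count.
  rewrite (eq_bigl xpredT) => [|j]; last by rewrite ltn_ord.
  by rewrite sum_m subKn.
by rewrite rounds_fromS /= twice -alive_countS.
Qed.

Lemma games_poly_format (R : realType) s : (s <= r)%N ->
  games_poly (rounds_from s) (alive_count n m s) =
  \prod_(j < r | (s <= j)%N)
    ((1 - (2 * m j)%:R / (alive_count n m j)%:R)%:P
     + ((2 * m j)%:R / (alive_count n m j)%:R) *: 'X) :> {poly R}.
Proof.
elim/round_ind: s / => [|s IH].
  rewrite rounds_from_end /= big1 // => j rj.
  by have := ltn_ord j; rewrite ltnNge rj.
rewrite rounds_fromS /= -alive_countS IH [RHS](bigD1 s) //=; congr (_ * _).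
by apply: eq_bigl => j; rewrite ltn_neqAle eq_sym andbC.
Qed.

End Format.

Section Tournament.
Context {R : realType} {n r : nat} {d : measure_display}.
Context {Omega : measurableType d} {P : probability Omega R}.
Variables (v : 'I_n -> R) (m : 'I_r -> nat) (T : 'I_r -> Omega -> round n).
Hypothesis tour : is_tournament P v m T.

Definition history (w : Omega) : {ffun 'I_r -> round n} := [ffun s => T s w].

Definition past (h : 'I_r -> round n) (s : nat) : set Omega :=
  [set w | forall j : 'I_r, (j < s)%N -> T j w = h j].

Lemma history_fibers h : measurable (history @^-1` [set h]).
Proof.
have -> : history @^-1` [set h] = \bigcap_(s in [set: 'I_r]) T s @^-1` [set h s].
  apply/seteqP; split=> [w <- s _ /=|w hw]; first by rewrite ffunE.
  by apply/ffunP => s; rewrite ffunE; exact: hw.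
by apply: fin_bigcap_measurable => // s _; exact: tour.1.
Qed.

Lemma measurable_past h s : measurable (past h s).
Proof.
have -> : past h s = history @^-1` [set g | forall j : 'I_r, (j < s)%N -> g j = h j].
  by apply/seteqP; split=> w hw j js; have := hw j js; rewrite ffunE.
exact: (measurable_finite_preimage history_fibers).
Qed.

Lemma measurable_wins i : measurable (wins T i).
Proof.
have -> : wins T i = history @^-1` [set g | alive g r = [set i]%SET].
  have E w : alive (history w) r = alive (fun s => T s w) r.
    by congr (~: _)%SET; apply: eq_bigr => j _; rewrite ffunE.
  by apply/seteqP; split=> w /=; rewrite /wins /= E.
exact: (measurable_finite_preimage history_fibers).
Qed.

Lemma eq_alive (g h : 'I_r -> round n) s :
  (forall j : 'I_r, (j < s)%N -> g j = h j) -> alive g s = alive h s.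
Proof. by move=> gh; congr (~: _)%SET; apply: eq_bigr => j /gh ->. Qed.

Lemma aliveS (h : 'I_r -> round n) (s : 'I_r) :
  alive h s.+1 = (alive h s :\: losers (h s))%SET.
Proof.
rewrite /alive (bigD1 s) //= finset.setCU finset.setIC finset.setDE.
congr (~: _ :&: _)%SET; apply: eq_bigl => j.
by rewrite ltnS ltn_neqAle andbC.
Qed.

(** Splitting over the outcome x of the next round turns the chain rule of the
    tournament into the recursion that defines [win_prob]. *)
Lemma wins_past i h s : (s <= r)%N ->
  P (wins T i `&` past h s) =
  (P (past h s) * (win_prob v i (rounds_from m s) (alive h s))%:E)%E.
Proof.
move=> sr; move: s sr h; apply: round_ind => [|s IH] h.
  rewrite rounds_from_end /=.
  have E w : past h r w -> alive (fun s => T s w) r = alive h r.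
    by move=> hw; exact: eq_alive.
  have [ai|/eqP ai] := eqVneq (alive h r) [set i]%SET.
    rewrite mule1; congr (P _); apply/seteqP; split=> [w []//|w hw].
    by split=> //; rewrite /wins /= (E w hw).
  rewrite mule0 -[RHS](measure0 P); congr (P _); apply/seteqP; split=> // w [].
  by rewrite /wins /= => aw hw; apply: ai; rewrite -(E w hw).
(* The history h, continued by x in round s. *)
pose upd x j := if j == s then x else h j.
have updE x : past (upd x) s.+1 = past h s `&` T s @^-1` [set x].
  apply/seteqP; split=> [w hw|w [hw /= xw] j].
    split=> [j js|]; last by have := hw s (ltnSn s); rewrite /upd eqxx.
    have := hw j (ltnW js); rewrite /upd; case: eqP js => // ->.
    by rewrite ltnn.
  rewrite /upd; case: eqVneq => [-> _ //|js].
  by rewrite ltnS leq_eqVlt val_eqE (negPf js); exact: hw.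
have upd_lt x (j : 'I_r) : (j < s)%N -> upd x j = h j.
  by rewrite /upd; case: eqP => // ->; rewrite ltnn.
have past_upd x : past (upd x) s = past h s.
  by apply/seteqP; split=> w hw j js; have := hw j js; rewrite upd_lt.
rewrite (measure_split (tour.1 s)); last first.
  by apply: measurableI; [exact: measurable_wins | exact: measurable_past].
have [p Pp] : exists p, P (past h s) = p%:E.
  exists (fine (P (past h s))); rewrite fineK // fin_num_measure //.
  exact: measurable_past.
rewrite rounds_fromS /= Pp -EFinM mulr_sumr -sumEFin.
apply: eq_bigr => x _; rewrite -setIA -updE IH.
have := tour.2 (upd x) s; rewrite -/(past _ s.+1) -/(past _ s) past_upd Pp => ->.
rewrite -!EFinM aliveS (eq_alive (upd_lt x)).
by rewrite /upd eqxx -mulrA.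
Qed.

Lemma wins_prob i :
  P (wins T i) = (win_prob v i (rounds_from m 0) [set: 'I_n]%SET)%:E.
Proof.
pose h (_ : 'I_r) : round n := (finset.set0, finset.set0, finset.set0).
have past0 : past h 0 = setT by apply/seteqP; split.
have := wins_past i h (leq0n r); rewrite past0 setIT => ->.
rewrite probability_setT mul1e; congr (win_prob _ _ _ _)%:E.
by rewrite /alive big_pred0 // finset.setC0.
Qed.
End Tournament.

Local Open Scope ring_scope.

(** * The lower bound *)

Lemma prod_strongest_le (R : realType) n (i : 'I_n) g (f : 'I_n -> R) :
  (g <= i)%N -> \prod_(k in strongest i g) f k = \prod_(k < n | (k < g)%N) f k.
Proof.
move=> gi; apply: eq_bigl => k; rewrite inE (ltnNge i) gi addn0.
by apply/andb_idl => kg; rewrite -val_eqE neq_ltn (leq_trans kg gi).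
Qed.

Lemma prod_strongest_gt (R : realType) n (i : 'I_n) g (f : 'I_n -> R) :
  (i < g)%N -> \prod_(k in strongest i g) f k =
  \prod_(k < n | (k < i)%N) f k * \prod_(k < n | (i < k <= g)%N) f k.
Proof.
move=> ig; rewrite (bigID (fun k : 'I_n => k < i)%N) /=.
by congr (_ * _); apply: eq_bigl => k; rewrite inE ig addn1 ltnS -val_eqE /=; lia.
Qed.

Theorem theorem3 (R : realType) (n : nat) (v : 'I_n -> R)
  (r : nat) (m : 'I_r -> nat)
  (d : measure_display) (Omega : measurableType d) (P : probability Omega R)
  (T : 'I_r -> Omega -> round n)
  (d' : measure_display) (Omega' : measurableType d') (Q : probability Omega' R)
  (X : 'I_r -> {RV Q >-> R}) (i : 'I_n) :
  (2 <= n)%N ->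
  (forall k : 'I_n, 0 < v k) ->
  (forall j k : 'I_n, (j <= k)%N -> v k <= v j) ->
  is_format n m ->
  is_tournament P v m T ->
  mutually_independent X ->
  (forall j : 'I_r,
     Q [set w | X j w = 1] = ((2 * m j)%:R / (alive_count n m j)%:R)%:E /\
     Q [set w | X j w = 0] = (1 - (2 * m j)%:R / (alive_count n m j)%:R)%:E) ->
  let probN (g : nat) : R :=
    fine (Q [set w | \sum_(j < r) X j w = g%:R]) in
  \sum_(1 <= g < i.+1)
     probN g * \prod_(k < n | (k < g)%N) (v i / (v i + v k))
  + \sum_(i.+1 <= g < r.+1)
     probN g * (\prod_(k < n | (k < i)%N) (v i / (v i + v k))
                * \prod_(k < n | (i < k <= g)%N) (v i / (v i + v k)))
  <= fine (P (wins T i)).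
Proof.
move=> n2 v_gt0 v_dec fm tour indep X01; cbv beta zeta.
pose p j : R := (2 * m j)%:R / (alive_count n m j)%:R.
pose q := bernoulli_gen p.
have probNE g : fine (Q [set w | \sum_(j < r) X j w = g%:R]) = q`_g.
  by rewrite (bernoulli_sum_law indep (fun j => (X01 j).1) (fun j => (X01 j).2)).
have q_ge0 g : 0 <= q`_g by rewrite -probNE fine_ge0.
pose b g := \prod_(k in strongest i g) match_prob v i k.
have b_ge0 g : 0 <= b g by apply: prodr_ge0 => k _; rewrite ltW ?match_prob_gt0.
have bound : poly_mean q b <= fine (P (wins T i)).
  have n0 : (0 < n)%N by exact: ltnW.
  have iT : i \in [set: 'I_n]%SET by rewrite inE.
  have D0 : fintype.disjoint (mem (finset.set0 : {set 'I_n})) (mem [set: 'I_n]%SET).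
    by rewrite finset.disjoints_subset finset.sub0set.
  have := fits_format n0 fm (leq0n r).
  have := win_prob_ge (ms := rounds_from m 0) v_gt0 v_dec iT D0.
  rewrite cardsT card_ord cards0 finset.big_set0 mul1r alive_count0 => le_win /le_win.
  rewrite (wins_prob tour) /= -[X in games_poly _ X](alive_count0 m).
  by rewrite games_poly_format.
apply: le_trans bound.
(* All terms being nonnegative, the term of index 0 and those beyond max(i, r) can be
   dropped; the range must reach i even when r < i. *)
rewrite (@poly_mean_widen _ (maxn i.+1 r.+1 + size q)) ?leq_addl //.
rewrite -(big_mkord xpredT (fun g => q`_g * b g)) /=.
have sum_ge0 a c : 0 <= \sum_(a <= g < c) q`_g * b g.
  by apply: sumr_ge0 => g _; rewrite mulr_ge0.
rewrite [leRHS](big_cat_nat (n := maxn i.+1 r.+1)) ?leq_addr //=.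
apply: ler_wpDr; first exact: sum_ge0.
rewrite [leRHS](big_cat_nat (n := 1)) ?leq_max //=.
apply: ler_wpDl; first exact: sum_ge0.
rewrite [leRHS](big_cat_nat (n := i.+1)) ?leq_max ?leqnn //=.
rewrite le_eqVlt; apply/orP; left; apply/eqP; congr (_ + _).
  apply: eq_big_nat => g /andP[_ gi]; rewrite probNE /b prod_strongest_le //.
transitivity (\sum_(i.+1 <= g < r.+1) q`_g * b g).
  by apply: eq_big_nat => g /andP[ig _]; rewrite probNE /b prod_strongest_gt.
have [ir|ri] := leqP i r; first by rewrite (maxn_idPr _).
by rewrite (maxn_idPl _) ?big_geq // ltnW.
Qed.
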